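(* For every integer $N\geq 3$, let $D_l(N)$, $D_q(N)$ and $D(N)$ be the numbers of linear doilies, of quadratic doilies and of all doilies in $\mathcal{W}(2N-1,2)$, respectively. Then $$D_q(N) = \left(4^{N-2}-1\right) D_l(N) \qquad\text{and}\qquad D(N) = 4^{N-2} D_l(N).$$
   Context: $\mathrm{PG}(d,2)$ is the projective space of $\mathbb{F}_2^{d+1}$; its points are the nonzero vectors and its lines the triples $\{a,b,a+b\}$. $\mathcal{W}(2N-1,2)$ is the symplectic polar space whose points are all points of $\mathrm{PG}(2N-1,2)$ (nonzero vectors of $\mathbb{F}_2^{2N}$) and whose subspaces are those totally isotropic for the symplectic form $\sigma(x,y)=\sum_{j=1}^N (x_j y_{N+j}+x_{N+j}y_j)$. Its lines are the triples $\{a,b,a+b\}$ with $a\neq b$ nonzero and $\sigma(a,b)=0$. The doily is the unique generalized quadrangle $\mathrm{GQ}(2,2)$ (15 points, 15 lines, 3 points per line, 3 lines per point, and for each point $p$ not on a line $L$ there is a unique point of $L$ collinear with $p$). A doily in $\mathcal{W}(2N-1,2)$ (an $N$-qubit doily) is a set of 15 points of $\mathcal{W}(2N-1,2)$ together with 15 lines of $\mathcal{W}(2N-1,2)$ on these points, forming an incidence structure isomorphic to the doily, such that two distinct points $a,b$ of it satisfy $\sigma(a,b)=0$ if and only if they lie on a common line of it. Such a doily is called linear if its 15 points span a $\mathrm{PG}(3,2)$ (a 4-dimensional vector subspace of $\mathbb{F}_2^{2N}$), and quadratic if its 15 points span a $\mathrm{PG}(4,2)$ (a 5-dimensional vector subspace).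 *)

(* Defs.v *)
From mathcomp Require Import all_boot all_order all_algebra.

Set Implicit Arguments.
Unset Strict Implicit.
Unset Printing Implicit Defensive.

Import GRing.Theory.
Local Open Scope ring_scope.

(* A point-line geometry is a pair (P, L), with each line identified with the
   set of points on it. *)

Definition collinear (T : finType) (L : {set {set T}}) (p q : T) : bool :=
  [exists l in L, (p \in l) && (q \in l)].

(* The axioms of GQ(2,2). The doily is the unique such geometry up to
   isomorphism, so (P, L) is isomorphic to it iff these axioms hold. *)
Definition is_GQ22 (T : finType) (P : {set T}) (L : {set {set T}}) : bool :=
  [&& #|P| == 15%N,
      #|L| == 15%N,
      [forall l in L, (l \subset P) && (#|l| == 3%N)],
      [forall p in P, #|[set l in L | p \in l]| == 3%N],
      [forall l in L, forall m in L, (l != m) ==> (#|l :&: m| <= 1)%N]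
    & [forall l in L, forall p in P :\: l,
         #|[set q in l | collinear L p q]| == 1%N]].

(* F_2^(2N) is 'rV['F_2]_(N + N); the coordinates x_j and x_(N+j) are indexed
   by lshift N j and rshift N j. *)

Definition sigma (N : nat) (x y : 'rV['F_2]_(N + N)) : 'F_2 :=
  \sum_(j < N) (x 0 (lshift N j) * y 0 (rshift N j)
                + x 0 (rshift N j) * y 0 (lshift N j)).

Definition W_point (N : nat) (x : 'rV['F_2]_(N + N)) : bool := x != 0.

Definition W_line (N : nat) (l : {set 'rV['F_2]_(N + N)}) : bool :=
  [exists a, exists b,
    [&& W_point a, W_point b, a != b, sigma a b == 0
      & l == [set a; b; a + b]]].

Definition geometry (N : nat) : finType :=
  ({set 'rV['F_2]_(N + N)} * {set {set 'rV['F_2]_(N + N)}})%type.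

Definition is_doily (N : nat) (D : geometry N) : bool :=
  [&& [forall p in D.1, W_point p],
      [forall l in D.2, W_line l],
      is_GQ22 D.1 D.2
    & [forall a in D.1, forall b in D.1,
         (a != b) ==> ((sigma a b == 0) == collinear D.2 a b)]].

Definition span_dim (N : nat) (D : geometry N) : nat :=
  \dim <<enum D.1>>%VS.

Definition is_linear_doily (N : nat) (D : geometry N) : bool :=
  is_doily D && (span_dim D == 4%N).

Definition is_quadratic_doily (N : nat) (D : geometry N) : bool :=
  is_doily D && (span_dim D == 5%N).

Definition num_linear (N : nat) : nat :=
  #|[set D : geometry N | is_linear_doily D]|.

Definition num_quadratic (N : nat) : nat :=
  #|[set D : geometry N | is_quadratic_doily D]|.

Definition num_doilies (N : nat) : nat :=
  #|[set D : geometry N | is_doily D]|.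

(* Main.v *)
Require Import Defs.
From mathcomp Require Import all_boot all_order all_algebra.

(** A doily contains points a, c, b, d with sigma(a,c) = sigma(b,d) = 1, all
    other products being 0. The trace {a,c}^perp within the doily consists of b,
    d and a third point e, and r = b + d + e is orthogonal to a, c, b, d. The
    geometry then forces the doily to be the set of the comb(h) + q(h) r, h a
    nonzero vector of F_2^4, where comb(h) has coordinates h in the basis
    (a, c, b, d) and q(h) = h1 h2 + h3 h4; conversely every such pair
    (symplectic tuple, r orthogonal to it) gives a doily, linear iff r = 0.
    Each doily arises from the same number of pairs, the number of symplectic
    tuples of nonzero labels in F_2^4, since labelling preserves the form; and
    each tuple admits 4^(N-2) vectors r. *)

Set Implicit Arguments.
Unset Strict Implicit.
Unset Printing Implicit Defensive.

Import GRing.Theory.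
Local Open Scope ring_scope.

(** * Labels: F_2^4 with its symplectic and quadratic forms *)

Definition label : finType := (bool * bool * bool * bool)%type.

Definition label0 : label := (false, false, false, false).

Definition label_add (h k : label) : label :=
  let: (h1, h2, h3, h4) := h in let: (k1, k2, k3, k4) := k in
  (h1 (+) k1, h2 (+) k2, h3 (+) k3, h4 (+) k4).

Definition label_form (h k : label) : bool :=
  let: (h1, h2, h3, h4) := h in let: (k1, k2, k3, k4) := k in
  (h1 && k2) (+) (h2 && k1) (+) (h3 && k4) (+) (h4 && k3).

(** The hyperbolic quadratic form on F_2^4 whose polarization is [label_form]. *)
Definition label_quad (h : label) : bool :=
  let: (h1, h2, h3, h4) := h in (h1 && h2) (+) (h3 && h4).

Definition labels : seq label :=
  [seq (x, y) | x <- [seq (x, y) | x <- [seq (x, y) | x <- [:: false; true],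
    y <- [:: false; true]], y <- [:: false; true]], y <- [:: false; true]].

Lemma mem_labels h : h \in labels.
Proof. by case: h => [[[[] []] []] []]. Qed.

(** Reduces a statement about all labels to a boolean check over 16 values, so that nested
    quantifiers can be settled by computation. *)
Lemma label_ind (Q : pred label) : all Q labels -> forall h, Q h.
Proof. by move=> /allP QP h; apply: QP; apply: mem_labels. Qed.

Lemma label_quadD h k :
  label_quad (label_add h k) =
    label_quad h (+) label_quad k (+) label_form h k.
Proof. by case: h => [[[[] []] []] []]; case: k => [[[[] []] []] []]. Qed.

Lemma label_addK h k : label_add h (label_add h k) = k.
Proof. by case: h => [[[[] []] []] []]; case: k => [[[[] []] []] []]. Qed.

Lemma label_add_eq0 h k : (label_add h k == label0) = (h == k).
Proof. by case: h => [[[[] []] []] []]; case: k => [[[[] []] []] []]. Qed.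

Lemma label_formC h k : label_form h k = label_form k h.
Proof. by case: h => [[[[] []] []] []]; case: k => [[[[] []] []] []]. Qed.

Lemma label_form_addr h k : label_form h (label_add h k) = label_form h k.
Proof. by case: h => [[[[] []] []] []]; case: k => [[[[] []] []] []]. Qed.

(* Of the two points k and h + k completing h to a line, exactly one has lead 0. *)
Definition label_lead (h k : label) : bool :=
  let: (h1, h2, h3, h4) := h in let: (k1, k2, k3, k4) := k in
  if h1 then k1 else if h2 then k2 else if h3 then k3 else k4.

Lemma label_lead_self h : h != label0 -> label_lead h h.
Proof. by case: h => [[[[] []] []] []]. Qed.

Lemma label_lead_add h k :
  h != label0 -> label_lead h (label_add h k) = ~~ label_lead h k.
Proof. by case: h => [[[[] []] []] []]; case: k => [[[[] []] []] []]. Qed.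

(* A symplectic space of dimension 4 has no totally isotropic 3-space. *)
Lemma label_form_line g h k :
    g != label0 -> h != label0 -> k != label0 ->
    [&& g != h, g != k & g != label_add h k] ->
  h != k -> ~~ label_form h k -> label_form g h || label_form g k.
Proof.
pose Q := fun g h k => [==> g != label0, h != label0, k != label0,
    [&& g != h, g != k & g != label_add h k], h != k, ~~ label_form h k =>
    label_form g h || label_form g k].
suff : Q g h k by rewrite /Q; do 6!move/implyP => /[apply].
have : all (fun g => all (fun h => all (Q g h) labels) labels) labels.
  by vm_compute.
by move=> /label_ind/(_ g) /label_ind/(_ h) /label_ind/(_ k).
Qed.

(** * The form on V and its isotropic lines *)

Section Symplectic.

Variable N : nat.
Local Notation V := 'rV['F_2]_(N + N).
Implicit Types (x y z a b c d r : V) (t : V * V * V * V) (h k : label).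

(** Boolean version of [sigma]: bilinearity over F_2 becomes additivity for exclusive or, and
    products can be treated by cases. *)
Definition sp x y : bool := sigma x y != 0.

Lemma addF2_neq0 (u v : 'F_2) : (u + v != 0) = (u != 0) (+) (v != 0).
Proof. by move: u v => [[|[|u]] hu] [[|[|v]] hv]. Qed.

Lemma sigmaDl x y z : sigma (x + y) z = sigma x z + sigma y z.
Proof.
by rewrite /sigma -big_split; apply: eq_bigr => j _ /=; rewrite !mxE !mulrDl addrACA.
Qed.

Lemma sigmaC x y : sigma x y = sigma y x.
Proof.
by apply: eq_bigr => j _; rewrite addrC [X in X + _]mulrC [X in _ + X]mulrC.
Qed.

Lemma addvv x : x + x = 0.
Proof.
apply/rowP => i; rewrite !mxE.
by move: (x 0 i) => [[|[|u]] hu] //; apply/val_inj.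
Qed.

Lemma addvK x y : x + (x + y) = y.
Proof. by rewrite addrA addvv add0r. Qed.

Lemma addv_eq0 x y : (x + y == 0) = (x == y).
Proof.
by rewrite -(inj_eq (addrI x)) addvK addr0 eq_sym.
Qed.

Lemma spC x y : sp x y = sp y x.
Proof. by rewrite /sp sigmaC. Qed.

Lemma spDl x y z : sp (x + y) z = sp x z (+) sp y z.
Proof. by rewrite /sp sigmaDl addF2_neq0. Qed.

Lemma spDr x y z : sp x (y + z) = sp x y (+) sp x z.
Proof. by rewrite !(spC x) spDl. Qed.

Lemma spxx x : sp x x = false.
Proof.
rewrite /sp /sigma big1 ?eqxx // => j _; rewrite mulrC.
by move: (_ * _) => [[|[|u]] hu] //; apply/val_inj.
Qed.

Lemma sp0l x : sp 0 x = false.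
Proof. by rewrite -(addvv 0) spDl addbb. Qed.

Lemma sp_mulbl x y (e : bool) : sp (x *+ e) y = e && sp x y.
Proof. by case: e; rewrite // sp0l. Qed.

Definition line x y : {set V} := [set x; y; x + y].

Lemma line_eq u v x y :
  u != v -> u \in line x y -> v \in line x y -> line u v = line x y.
Proof.
move=> uv; rewrite !inE -!orbA => /or3P[] /eqP eu /or3P[] /eqP ev;
  move: uv; rewrite eu ev ?eqxx // => _; apply/setP=> w; rewrite !inE;
  rewrite ?addvK ?(addrC x y) ?(addrC _ y) ?addvK ?(addrC _ x) ?addvK ?(addrC y x) ?addvK //;
  do !case: (w == _) => //=.
Qed.

Lemma card_line x y : x != 0 -> y != 0 -> x != y -> #|line x y| = 3%N.
Proof.
move=> x0 y0 xy; rewrite /line setUC cardsU1 cards2 xy !inE negb_or.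
rewrite -[X in x + y != X]addr0 (inj_eq (addrI x)) y0.
by rewrite -[X in x + y != X]add0r (inj_eq (addIr y)) x0.
Qed.

(** Only two generating points are asked to lie in [P]; for the point sets of doilies the third one
    follows. *)
Definition lines_of (P : {set V}) : {set {set V}} :=
  [set l | [exists a in P, exists b in P,
             [&& a != b, ~~ sp a b & l == line a b]]].

Lemma lines_ofP (P : {set V}) (l : {set V}) :
  reflect (exists a b, [/\ a \in P, b \in P, a != b, ~~ sp a b & l = line a b])
          (l \in lines_of P).
Proof.
rewrite inE; apply: (iffP exists_inP) => [[a aP /exists_inP[b bP]]|].
  by case/and3P=> ab sab /eqP ->; exists a, b.
case=> a [b [aP bP ab sab ->]]; exists a => //; apply/exists_inP; exists b => //.
by rewrite ab sab eqxx.
Qed.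

Definition symplectic_tuple t : bool :=
  let: (a, c, b, d) := t in
  [&& sp a c, sp b d, ~~ sp a b, ~~ sp a d, ~~ sp c b & ~~ sp c d].

Definition tuples_in (A : {set V}) : {set V * V * V * V} :=
  [set t | let: (a, c, b, d) := t in
     [&& a \in A, c \in A, b \in A, d \in A & symplectic_tuple t]].

(** * Consequences of the doily axioms *)

Section Doily.

Variable D : geometry N.
Hypothesis dD : is_doily D.
Local Notation P := D.1.
Local Notation L := D.2.

Lemma doily_neq0 x : x \in P -> x != 0.
Proof. by case/and4P: dD => /forall_inP + _ _ _; apply. Qed.

Lemma doily_line_sub l : l \in L -> l \subset P.
Proof.
case/and4P: dD => _ _ /and5P[_ _ /forall_inP + _ _] _ => /[apply].
by case/andP.
Qed.

Lemma doily_card : #|P| = 15%N.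
Proof. by case/and4P: dD => _ _ /and5P[/eqP]. Qed.

Lemma doily_degree x : x \in P -> #|[set l in L | x \in l]| = 3%N.
Proof.
case/and4P: dD => _ _ /and5P[_ _ _ /forall_inP + _] _ => /[apply].
by move/eqP.
Qed.

Lemma doily_W_line l :
  l \in L -> exists a b, [/\ a != b, ~~ sp a b & l = line a b].
Proof.
case/and4P: dD => _ /forall_inP + _ _ => /[apply] /existsP[a /existsP[b]].
by case/and5P=> _ _ ab sab /eqP ->; exists a, b; rewrite /sp sab.
Qed.

Lemma doily_collinear x y :
  x \in P -> y \in P -> x != y -> collinear L x y = ~~ sp x y.
Proof.
move=> xP yP xy; case/and4P: dD => _ _ _ /forall_inP/(_ x xP)/forall_inP/(_ y yP).
by rewrite xy /sp negbK => /eqP ->.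
Qed.

Lemma doily_line_mem x y :
  x \in P -> y \in P -> x != y -> ~~ sp x y -> line x y \in L.
Proof.
move=> xP yP xy; rewrite -doily_collinear // => /exists_inP[l lL /andP[xl yl]].
have [a [b [_ _ el]]] := doily_W_line lL.
by rewrite (_ : line x y = l) // el; apply: line_eq => //; rewrite -el.
Qed.

Lemma doily_add x y :
  x \in P -> y \in P -> x != y -> ~~ sp x y -> x + y \in P.
Proof.
move=> xP yP xy sxy; have /doily_line_sub/subsetP := doily_line_mem xP yP xy sxy.
by apply; rewrite !inE eqxx orbT.
Qed.

(** Orthogonality decides collinearity, so the points determine the lines and a doily can be handled
    through its point set alone. *)
Lemma doily_lines : L = lines_of P.
Proof.
apply/setP => l; apply/idP/lines_ofP => [lL | [a [b [aP bP ab sab ->]]]]; last first.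
  exact: doily_line_mem.
have [a [b [ab sab el]]] := doily_W_line lL.
have /subsetP lP := doily_line_sub lL.
by exists a, b; split; rewrite // lP // el !inE eqxx ?orbT.
Qed.

(** A generalized quadrangle has no triangles: if [y] and [z] were orthogonal, [z] would be
    collinear with both [x] and [y] on a line missing [z]. *)
Lemma doily_triangle x y z :
    x \in P -> y \in P -> z \in P -> y != z -> z \notin line x y ->
  ~~ sp x y -> ~~ sp x z -> x != y -> sp y z.
Proof.
move=> xP yP zP yz zl sxy sxz xy; apply: contraT => syz.
have xz : x != z by apply: contraNneq zl => ->; rewrite !inE eqxx.
have lL := doily_line_mem xP yP xy sxy.
case/and4P: dD => _ _ /and5P[_ _ _ _ /andP[_]].
move=> /forall_inP/(_ _ lL)/forall_inP/(_ z); rewrite inE zl zP => /(_ isT).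
move=> /eqP eq1 _; set A := [set q in _ | _] in eq1.
suff /subset_leq_card: [set x; y] \subset A by rewrite eq1 cards2 xy.
apply/subsetP => w.
rewrite !inE; have cz u : u \in P -> u != z -> ~~ sp u z -> collinear L z u.
  by move=> uP uz suz; rewrite doily_collinear // 1?spC // eq_sym.
by case/orP=> /eqP ->; rewrite eqxx ?orbT cz.
Qed.

(** Three lines pass through [a], so one of them differs from both given sets, and its points other
    than [a] avoid them. Taking [x = y] avoids a single line. *)
Lemma doily_third_line a x y :
    a \in P ->
  exists z, [/\ z \in P, z != a, ~~ sp a z, z \notin line a x & z \notin line a y].
Proof.
move=> aP; have: ~~ ([set l in L | a \in l] \subset [set line a x; line a y]).
  apply: contraTN (leqnn 3) => /subset_leq_card.
  by rewrite doily_degree // cards2; case: eqP.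
case/subsetPn => l; rewrite !inE negb_or => /andP[lL al] /andP[lx ly].
suff [z [zP za saz el]] :
    exists z, [/\ z \in P, z != a, ~~ sp a z & l = line a z].
  exists z; split=> //; rewrite el in lx ly.
    apply: contraNN lx => zx; apply/eqP/line_eq => //; first by rewrite eq_sym.
    by rewrite !inE eqxx.
  apply: contraNN ly => zx; apply/eqP/line_eq => //; first by rewrite eq_sym.
  by rewrite !inE eqxx.
(* The point [a] is one of [u], [v], [u + v]; another generator of the line serves as [z]. *)
have := lL; rewrite doily_lines => /lines_ofP[u [v [uP vP uv suv el]]].
move: al; rewrite el !inE -orbA => /or3P[] /eqP ->.
- by exists v; rewrite eq_sym.
- exists u; rewrite spC; split=> //; symmetry.
  by apply: line_eq; rewrite 1?eq_sym // !inE eqxx ?orbT.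
have ne : u != u + v.
  rewrite -[X in X != _]addr0 (inj_eq (addrI u)) eq_sym; exact: doily_neq0.
exists u; rewrite spDl spxx spC; split=> //; symmetry.
by apply: line_eq; rewrite 1?eq_sym // !inE eqxx ?orbT.
Qed.

(** On a third line {a, z, a + z} through [a], exactly one of [z] and [a + z] is orthogonal to [c],
    because [sp a c] holds. *)
Lemma doily_hyperbolic_line a c x y :
    a \in P -> c \in P -> sp a c ->
  exists z, [/\ z \in P, ~~ sp a z, ~~ sp c z, z \notin line a x
                & z \notin line a y].
Proof.
move=> aP cP sac; have [z [zP za saz zx zy]] := doily_third_line x y aP.
case scz: (sp c z); last by exists z; rewrite scz.
have az : line a (a + z) = line a z.
  apply: line_eq; rewrite ?inE ?eqxx ?orbT //.
  rewrite -[X in X != _]addr0 (inj_eq (addrI a)) eq_sym; exact: doily_neq0.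
have notin u : z \notin line a u -> a + z \notin line a u.
  rewrite !inE !negb_or -!andbA => /and3P[_ zu zau].
  have /negbTE -> : a + z != a.
    rewrite -[X in _ != X]addr0 (inj_eq (addrI a)); exact: doily_neq0.
  by rewrite (inj_eq (addrI a)) zu andbT -(inj_eq (addrI a)) addvK.
exists (a + z); rewrite !spDr spxx (spC c) sac scz; split=> //; try exact: notin.
by rewrite doily_add // eq_sym.
Qed.

Lemma doily_tuple : exists t, t \in tuples_in P.
Proof.
have /card_gt0P[b bP] : (0 < #|P|)%N by rewrite doily_card.
(* Two lines through [b] provide [a] and [c], which are not orthogonal for lack of triangles; [d] is
   then a point of the trace of {a, c} off the line through [a] and [b], hence not orthogonal to
   [b]. *)
have [a [aP ab sba aD _]] := doily_third_line b b bP.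
have [c [cP cb sbc cD _]] := doily_third_line a a bP.
have ac : a != c by apply: contraNneq cD => <-; rewrite !inE eqxx ?orbT.
have sac : sp a c by apply: (@doily_triangle b); rewrite // eq_sym.
have [d [dP sad scd dD' _]] := doily_hyperbolic_line b b aP cP sac.
exists (a, c, b, d); rewrite inE /= aP cP bP dP sac sad scd !(spC _ b) sba sbc.
rewrite !andbT /=; apply: (@doily_triangle a) => //; last by rewrite spC.
by apply: contraNneq dD' => <-; rewrite !inE eqxx ?orbT.
Qed.

End Doily.

(** * Frames and the points they parametrize *)

Definition comb t h : V :=
  let: (a, c, b, d) := t in let: (h1, h2, h3, h4) := h in
  a *+ h1 + c *+ h2 + b *+ h3 + d *+ h4.

(* The coordinates, in the basis t, of the projection of x onto the span of t. *)
Definition coords t x : label :=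
  let: (a, c, b, d) := t in (sp x c, sp x a, sp x d, sp x b).

Definition frame t r : bool := symplectic_tuple t && (coords t r == label0).

(** A linear embedding of F_2^4 twisted by the quadratic form in the direction [r]; it remains
    additive on orthogonal labels. *)
Definition point t r h : V := comb t h + r *+ label_quad h.

Definition points_of t r : {set V} := [set point t r h | h in [set~ label0]].

Definition doily_of (g : V * V * V * V * V) : geometry N :=
  (points_of g.1 g.2, lines_of (points_of g.1 g.2)).

Lemma mulr_addb x (e f : bool) : x *+ (e (+) f) = x *+ e + x *+ f.
Proof. by case: e; case: f; rewrite ?addvv ?addr0 ?add0r. Qed.

Lemma combD t h k : comb t (label_add h k) = comb t h + comb t k.
Proof.
case: t h k => [[[a c] b] d] [[[h1 h2] h3] h4] [[[k1 k2] k3] k4] /=.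
by rewrite !mulr_addb [RHS]addrACA; congr (_ + _); rewrite [RHS]addrACA;
  congr (_ + _); rewrite [RHS]addrACA.
Qed.

Lemma coordsD t x y : coords t (x + y) = label_add (coords t x) (coords t y).
Proof. by case: t => [[[a c] b] d]; rewrite /= !spDl. Qed.

Lemma coords0 t : coords t 0 = label0.
Proof. by case: t => [[[a c] b] d]; rewrite /= !sp0l. Qed.

Lemma coords_comb t h : symplectic_tuple t -> coords t (comb t h) = h.
Proof.
case: t h => [[[a c] b] d] [[[h1 h2] h3] h4] /=.
case/and5P=> sac sbd /negbTE sab /negbTE sad /andP[/negbTE scb /negbTE scd].
rewrite !spDl !sp_mulbl !spxx (spC c a) (spC b a) (spC d a) (spC b c) (spC d c).
by rewrite (spC d b) sac sbd sab sad scb scd !andbF !andbT /= ?addbF.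
Qed.

Lemma sp_comb t h x : sp (comb t h) x = label_form h (coords t x).
Proof.
case: t h => [[[a c] b] d] [[[h1 h2] h3] h4] /=.
by rewrite !spDl !sp_mulbl !(spC x).
Qed.

Lemma coords_mulb t x (e : bool) : coords t x = label0 -> coords t (x *+ e) = label0.
Proof. by case: e; rewrite // mulr0n coords0. Qed.

Lemma coords_point t r h : frame t r -> coords t (point t r h) = h.
Proof.
case/andP=> st /eqP tr; rewrite coordsD coords_comb // coords_mulb //.
by case: h => [[[[] []] []] []].
Qed.

Lemma point_inj t r : frame t r -> injective (point t r).
Proof. by move=> fr; apply: can_inj => h; apply: coords_point. Qed.

Lemma label_form0 h : label_form h label0 = false.
Proof. by case: h => [[[[] []] []] []]. Qed.

(** The twist does not affect products, since [r] is orthogonal to the tuple and to itself. *)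
Lemma sp_point t r h k :
  frame t r -> sp (point t r h) (point t r k) = label_form h k.
Proof.
move=> fr; have /andP[st /eqP tr] := fr.
rewrite {1}/point spDl sp_comb coords_point // sp_mulbl spC.
by rewrite /point spDl sp_comb tr label_form0 sp_mulbl spxx !andbF addbF.
Qed.

(** The defect of additivity of [label_quad] is [label_form], which vanishes on orthogonal
    labels. *)
Lemma point_add t r h k :
  ~~ label_form h k -> point t r h + point t r k = point t r (label_add h k).
Proof.
move=> /negbTE hk; rewrite /point combD label_quadD hk addbF mulr_addb.
exact: addrACA.
Qed.

Lemma comb0 t : comb t label0 = 0.
Proof. by case: t => [[[a c] b] d]; rewrite /= !addr0. Qed.

Lemma point0 t r : point t r label0 = 0.
Proof. by rewrite /point comb0 addr0. Qed.

Lemma point_eq0 t r h : frame t r -> (point t r h == 0) = (h == label0).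
Proof. by move=> fr; rewrite -(point0 t r) (inj_eq (point_inj fr)). Qed.

Lemma points_of_mem t r h : h != label0 -> point t r h \in points_of t r.
Proof. by move=> h0; apply: imset_f; rewrite !inE. Qed.

Lemma points_ofP t r x :
  reflect (exists2 h, h != label0 & x = point t r h) (x \in points_of t r).
Proof.
apply: (iffP imsetP) => [[h]|[h h0 ->]]; first by rewrite !inE; exists h.
by exists h; rewrite ?inE.
Qed.

Lemma card_points_of t r : frame t r -> #|points_of t r| = 15%N.
Proof.
move=> fr; rewrite card_imset; last exact: point_inj.
by rewrite cardsC1 !card_prod card_bool.
Qed.

Lemma comb_basis t :
  [/\ comb t (true, false, false, false) = t.1.1.1,
      comb t (false, true, false, false) = t.1.1.2,
      comb t (false, false, true, false) = t.1.2 &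
      comb t (false, false, false, true) = t.2].
Proof. by case: t => [[[a c] b] d]; rewrite /= !mulr0n !mulr1n !addr0 !add0r. Qed.

(** * Doilies are exactly the geometries of frames *)

Lemma doily_frame (D : geometry N) t :
    is_doily D -> t \in tuples_in D.1 ->
  exists2 r, frame t r & D = doily_of (t, r).
Proof.
move=> dD; case: t => [[[a c] b] d]; rewrite inE => /and5P[aP cP bP dP st].
have := st => /= /and5P[sac sbd sab sad /andP[scb scd]].
have [e [eP sae sce eb ed]] := doily_hyperbolic_line dD b d aP cP sac.
have aNu u : sp c u = false -> a != u.
  by move=> scu; apply: contraTneq sac => ->; rewrite spC scu.
have sbe : sp b e.
  apply: (doily_triangle dD aP bP eP _ eb); rewrite ?aNu ?(negbTE scb) //.
  by apply: contraNneq eb => <-; rewrite !inE eqxx ?orbT.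
have sde : sp d e.
  apply: (doily_triangle dD aP dP eP _ ed); rewrite ?aNu ?(negbTE scd) //.
  by apply: contraNneq ed => <-; rewrite !inE eqxx ?orbT.
(* This [r] makes [e] equal to b + d + r, the point with label (0,0,1,1), where [label_quad] is
   1. *)
set t := (a, c, b, d); pose r := b + d + e.
have fr : frame t r.
  rewrite /frame st /= !spDl !spxx !(spC _ c) !(spC _ a) (spC d b) (spC e) sbd.
  by rewrite (spC e) sbe sde (negbTE sab) (negbTE sad) (negbTE scb) (negbTE scd)
    (negbTE sae) (negbTE sce).
exists r => //; pose Q h := point t r h \in D.1.
have add h k : Q h -> Q k -> h != k -> ~~ label_form h k -> Q (label_add h k).
  rewrite /Q => hQ kQ hk fhk; rewrite -point_add //.
  by apply: (doily_add dD); rewrite ?(inj_eq (point_inj fr)) ?sp_point.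
have [Ea Ec Eb Ed] := comb_basis t.
have Qa : Q (true, false, false, false) by rewrite /Q /point Ea addr0.
have Qc : Q (false, true, false, false) by rewrite /Q /point Ec addr0.
have Qb : Q (false, false, true, false) by rewrite /Q /point Eb addr0.
have Qd : Q (false, false, false, true) by rewrite /Q /point Ed addr0.
have Qe : Q (false, false, true, true).
  by rewrite /Q /point /= !mulr0n !mulr1n !add0r /r addrA addvv add0r.
(* Starting from [a], [c], [b], [d], [e], sums of orthogonal labels reach all 15 nonzero labels; the
   numerals in [Q12] to [Q15] are the labels read in binary. *)
have Qab := add _ _ Qa Qb isT isT; have Qad := add _ _ Qa Qd isT isT.
have Qae := add _ _ Qa Qe isT isT; have Qcb := add _ _ Qc Qb isT isT.
have Qcd := add _ _ Qc Qd isT isT; have Qce := add _ _ Qc Qe isT isT.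
have Q15 := add _ _ Qab Qcd isT isT; have Q13 := add _ _ Qab Qce isT isT.
have Q14 := add _ _ Qad Qce isT isT; have Q12 := add _ _ Qb Q14 isT isT.
(* The parametrized points lie in the doily, and both sets have 15 elements. *)
have PQ : D.1 = points_of t r.
  apply/esym/eqP; rewrite eqEcard card_points_of // (doily_card dD) leqnn andbT.
  apply/subsetP => x /points_ofP[h h0 ->]; rewrite -/(Q h); move: h h0.
  by case=> [[[[] []] []] []].
by rewrite [D]surjective_pairing (doily_lines dD) PQ.
Qed.

(** The point with label (0,0,1,1) involves [r]. Coordinates in the common tuple force it to carry
    the same label for [r'], and the linear part cancels. *)
Lemma points_of_inj t r r' :
  frame t r -> frame t r' -> points_of t r = points_of t r' -> r = r'.
Proof.
move=> fr fr' E; pose h : label := (false, false, true, true).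
have := points_of_mem t r (isT : h != label0).
rewrite E => /points_ofP[k _ Ehk].
have hk : h = k by rewrite -(coords_point h fr) Ehk coords_point.
by move: Ehk; rewrite -hk => /addrI.
Qed.

(** The map [point t r] is injective, preserves products and respects sums of orthogonal labels, so
    the axioms reduce to facts about F_2^4. *)
Lemma doily_of_is_doily t r : frame t r -> is_doily (doily_of (t, r)).
Proof.
move=> fr; set P := points_of t r; set f := point t r.
have fI : injective f := point_inj fr.
have col x y : x \in P -> y \in P -> x != y -> collinear (lines_of P) x y = ~~ sp x y.
  move=> xP yP xy; apply/exists_inP/idP => [[l /lines_ofP[a [b [aP bP ab sab ->]]]]|sxy].
    case/andP; rewrite !inE -!orbA => /or3P[] /eqP ex /or3P[] /eqP ey;
      by rewrite ex ey ?spDl ?spDr ?spxx ?(spC b a) ?(negbTE sab).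
  exists (line x y); last by rewrite !inE !eqxx ?orbT.
  by apply/lines_ofP; exists x, y.
have lineE l : l \in lines_of P -> exists h k,
    [/\ h != label0, k != label0, h != k, ~~ label_form h k & l = line (f h) (f k)].
  case/lines_ofP => _ [_ [/points_ofP[h h0 ->] /points_ofP[k k0 ->]]].
  by rewrite (inj_eq fI) sp_point // => hk fhk ->; exists h, k.
have line3 l : l \in lines_of P -> (l \subset P) && (#|l| == 3%N).
  case/lineE => h [k [h0 k0 hk fhk ->]].
  rewrite card_line ?point_eq0 ?(inj_eq fI) // andbT.
  apply/subsetP => x; rewrite !inE -orbA => /or3P[] /eqP ->;
    rewrite ?point_add //; apply: points_of_mem => //.
  by rewrite label_add_eq0.
have deg3 p : p \in P -> #|[set l in lines_of P | p \in l]| = 3%N.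
  case/points_ofP => h h0 ->; rewrite -/(f h).
  (* Besides 0 and [h], six labels are orthogonal to [h]; they form three pairs {k, h + k}, one per
     line, and [label_lead] selects one label of each pair. *)
  pose s := [seq k <- labels | [&& k != label0, ~~ label_form h k & ~~ label_lead h k]].
  have -> : [set l in lines_of P | f h \in l] = [set line (f h) (f k) | k in s].
    apply/setP=> l; rewrite inE; apply/andP/imsetP => [[lL hl]|[k]].
      suff [k [k0 kh fhk ->]] : exists k, [/\ k != label0, k != h, ~~ label_form h k
          & l = line (f h) (f k)].
        have : (k \in s) || (label_add h k \in s).
          rewrite !mem_filter !mem_labels !andbT k0 label_form_addr fhk.
          by rewrite label_add_eq0 eq_sym kh label_lead_add //; case: label_lead.
        case/orP=> ks; first by exists k.
        exists (label_add h k) => //; rewrite -[f (label_add h k)]point_add //.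
        by apply: line_eq; rewrite ?(inj_eq fI) 1?eq_sym // !inE ?addvK eqxx ?orbT.
      case: (lineE _ lL) => u [v [u0 v0 uv fuv el]].
      move: hl; rewrite el !inE -orbA => /or3P[/eqP/fI ->|/eqP/fI ->|].
      - by exists v; split; rewrite // eq_sym.
      - exists u; rewrite label_formC; split=> //; apply/esym/line_eq;
          rewrite ?(inj_eq fI) ?inE ?eqxx ?orbT //.
        by rewrite eq_sym.
      rewrite point_add // (inj_eq fI) => /eqP ->.
      exists u; rewrite u0 label_formC label_form_addr fuv; split=> //.
        by rewrite -label_add_eq0 label_addK.
      have -> : f (label_add u v) = f u + f v by rewrite [RHS]point_add.
      apply/esym/line_eq; rewrite ?inE ?eqxx ?orbT //.
      by rewrite eq_sym -addv_eq0 addvK point_eq0.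
    rewrite mem_filter => /andP[/and3P[k0 fhk hk] _ ->].
    have kh : k != h by apply: contraNneq hk => ->; apply: label_lead_self.
    split; last by rewrite !inE eqxx.
    apply/lines_ofP; exists (f h), (f k).
    by rewrite !points_of_mem // (inj_eq fI) eq_sym sp_point.
  rewrite card_in_imset.
    rewrite (card_uniqP _) ?filter_uniq //.
    by move: h h0 @s; case=> [[[[] []] []] []].
  move=> k k'; rewrite !mem_filter => /andP[/and3P[k0 fhk hk] _].
  case/andP=> /and3P[k0' fhk' hk'] _ E.
  have : f k \in line (f h) (f k') by rewrite -E !inE eqxx orbT.
  rewrite !inE point_add // !(inj_eq fI) -orbA => /or3P[] /eqP // ek.
    by rewrite ek label_lead_self in hk.
  by rewrite ek label_lead_add // hk' in hk.
have card_lines : #|lines_of P| = 15%N.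
  (* Double counting of flags: three points on each line, three lines through each of the 15
     points. *)
  apply/eqP; rewrite -(@eqn_pmul2r 3) //; apply/eqP.
  rewrite -sum_nat_const -[RHS](_ : (#|P| * 3)%N = _); last by rewrite card_points_of.
  rewrite -sum_nat_const -(eq_bigr _ deg3).
  rewrite (eq_bigr (fun l : {set V} => \sum_(p in P | p \in l) 1)%N); last first.
    move=> l lL; have /andP[/subsetP lP /eqP <-] := line3 l lL.
    rewrite -sum1_card; apply: eq_bigl => x.
    by apply/idP/andP => [xl|[]//]; rewrite lP.
  rewrite (exchange_big_dep (mem P)) /=; last by move=> l p _ /andP[].
  apply: eq_bigr => p pP; rewrite -sum1_card; apply: eq_bigl => l.
  by rewrite inE pP.
apply/and4P; split.
- by apply/forall_inP => x /points_ofP[h h0 ->]; rewrite /W_point point_eq0.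
- apply/forall_inP => l /lines_ofP[x [y [xP yP xy sxy ->]]].
  have P0 u : u \in P -> u != 0 by case/points_ofP => h h0 ->; rewrite point_eq0.
  apply/existsP; exists x; apply/existsP; exists y.
  by rewrite /W_point !P0 // xy -[_ == 0]negbK sxy /=.
- apply/and5P; split; rewrite ?card_points_of ?card_lines //.
  + by apply/forall_inP => l /line3.
  + by apply/forall_inP => p /deg3 ->.
  apply/andP; split.
    apply/forall_inP => l lL; apply/forall_inP => m mL; apply/implyP.
    apply: contraNT; rewrite -ltnNge => /card_gt1P[x [y []]].
    rewrite !inE => /andP[xl xm] /andP[yl ym] xy.
    have [a [b [_ _ _ _ El]]] := lines_ofP _ _ lL.
    have [a' [b' [_ _ _ _ Em]]] := lines_ofP _ _ mL.
    by rewrite El Em in xl yl xm ym *; rewrite -(line_eq xy xl yl) -(line_eq xy xm ym).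
  apply/forall_inP => l lL; apply/forall_inP => p; rewrite inE => /andP[pl pP].
  have [x [y [xP yP xy sxy El]]] := lines_ofP _ _ lL.
  have /andP[/subsetP lP _] := line3 l lL.
  have -> : [set q in l | collinear (lines_of P) p q] = [set q in l | ~~ sp p q].
    apply/setP => q; rewrite !inE; case ql: (q \in l) => //=.
    by rewrite col // ?lP //; apply: contraNneq pl => ->.
  (* Otherwise [p] and the line would span a totally isotropic 3-space in the label space. *)
  have spp : sp p x || sp p y.
    move: pP xP yP pl xy sxy; rewrite El.
    move=> /points_ofP[g g0 ->] /points_ofP[h h0 ->] /points_ofP[k k0 ->].
    rewrite !inE !sp_point // !(inj_eq fI) => + hk fhk.
    rewrite point_add // !(inj_eq fI) !negb_or.
    by rewrite -andbA => gl; apply: label_form_line.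
  apply/cards1P.
  (* The functional [sp p] is nonzero on the span of [x] and [y], so it vanishes at exactly one of
     the three points, namely at [x + y] when it is 1 at both generators. *)
  exists (if ~~ sp p x then x else if ~~ sp p y then y else x + y).
  apply/setP => q; rewrite El !inE.
  have P0 u : u \in P -> u == 0 = false.
    by case/points_ofP => h /negbTE h0 ->; rewrite point_eq0.
  have xxy : x == x + y = false.
    by rewrite -addv_eq0 addvK P0.
  have yxy : y == x + y = false.
    by rewrite -addv_eq0 (addrC x) addvK P0.
  case: (eqVneq q x) => [->|qx] /=.
    by move: spp; case: (sp p x) => /=; rewrite ?eqxx //; case: (sp p y); rewrite /= ?(negbTE xy) ?xxy.
  case: (eqVneq q y) => [->|qy] /=.
    by move: spp; case: (sp p x); case: (sp p y) => //=; rewrite ?eqxx ?yxy // eq_sym (negbTE xy).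
  case: (eqVneq q (x + y)) => [->|qxy] /=.
    by rewrite spDr; move: spp; case: (sp p x); case: (sp p y) => //=; rewrite ?eqxx // eq_sym ?xxy ?yxy.
  by case: (sp p x); case: (sp p y); rewrite /= ?(negbTE qx) ?(negbTE qy) ?(negbTE qxy).
- apply/forall_inP => x xP; apply/forall_inP => y yP; apply/implyP => xy.
  by rewrite col // negbK.
Qed.

(** * Counting the frames of a doily *)

Definition symplectic_labels : {set label * label * label * label} :=
  [set u | let: (h, k, l, m) := u in
     [&& label_form h k, label_form l m, ~~ label_form h l, ~~ label_form h m,
         ~~ label_form k l & ~~ label_form k m]].

(** These are the ordered symplectic bases of F_2^4, as many as the order of Sp(4,2). Positivity
    lets this factor be cancelled in the final count. *)
Lemma symplectic_labels_gt0 : (0 < #|symplectic_labels|)%N.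
Proof.
apply/card_gt0P; exists ((true, false, false, false), (false, true, false, false),
  (false, false, true, false), (false, false, false, true)).
by rewrite inE.
Qed.

(** Labelling preserves the form, so it matches symplectic bases of labels with symplectic tuples of
    points; their labels are nonzero because each has a nonzero product. *)
Lemma card_tuples_in_points t r :
  frame t r -> #|tuples_in (points_of t r)| = #|symplectic_labels|.
Proof.
move=> fr; set f := point t r; have fI : injective f := point_inj fr.
pose F (u : label * label * label * label) :=
  (f u.1.1.1, f u.1.1.2, f u.1.2, f u.2).
have FI : injective F.
  by move=> [[[h k] l] m] [[[h' k'] l'] m'] [] /fI -> /fI -> /fI -> /fI ->.
rewrite -(card_imset _ FI); apply: eq_card => -[[[a c] b] d].
rewrite inE; apply/and5P/imsetP => [[]|[[[[h k] l] m]]].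
  case/points_ofP => h h0 -> /points_ofP[k k0 ->] /points_ofP[l l0 ->].
  case/points_ofP=> m m0 ->; rewrite /symplectic_tuple !sp_point // => s.
  by exists (h, k, l, m); rewrite // inE.
rewrite inE => s [-> -> -> ->].
have nz p q : label_form p q -> p != label0 /\ q != label0.
  by case: p q => [[[[] []] []] []] [[[[] []] []] []].
have /and5P[/nz[h0 k0] /nz[l0 m0] _ _ _] := s.
by rewrite /symplectic_tuple !sp_point // !points_of_mem.
Qed.

Lemma basis_in_points t r :
  [/\ t.1.1.1 \in points_of t r, t.1.1.2 \in points_of t r,
      t.1.2 \in points_of t r & t.2 \in points_of t r].
Proof.
have [<- <- <- <-] := comb_basis t.
have mem h : h != label0 -> ~~ label_quad h -> comb t h \in points_of t r.
  move=> h0 /negbTE qh; apply/points_ofP; exists h => //.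
  by rewrite /point qh addr0.
by rewrite !mem.
Qed.

Lemma tuple_in_points t r : frame t r -> t \in tuples_in (points_of t r).
Proof.
case/andP => st _; rewrite inE; have := basis_in_points t r.
by case: t st => [[[a c] b] d] st [/= -> -> -> ->].
Qed.

Definition frames : {set V * V * V * V * V} := [set g | frame g.1 g.2].

(** Forgetting [r] is a bijection from the frames of [D] to the tuples in [D]: onto by
    [doily_frame], one-to-one by [points_of_inj]. *)
Lemma card_frames_of_doily (D : geometry N) :
  is_doily D -> #|[set g in frames | doily_of g == D]| = #|symplectic_labels|.
Proof.
move=> dD; have [t tD] := doily_tuple dD.
have [r fr Dtr] := doily_frame dD tD.
rewrite -(card_tuples_in_points fr) -(card_in_imset (f := fst)).
  apply: eq_card => t'; apply/imsetP/idP => [[[t1 r1]]|].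
    rewrite !inE /= => /andP[fr1 /eqP E] ->.
    by rewrite -[points_of t r]/(doily_of (t, r)).1 -Dtr -E; have := tuple_in_points fr1; rewrite inE.
  rewrite -[points_of t r]/(doily_of (t, r)).1 -Dtr => t'D.
  have [r' fr' Dtr'] := doily_frame dD t'D.
  by exists (t', r') => //; rewrite !inE /= fr' -Dtr' eqxx.
move=> [t1 r1] [t2 r2]; rewrite !inE /=.
move=> /andP[fr1 /eqP <-] /andP[fr2 /eqP E] /= Et.
rewrite -Et in fr2 E *; congr (_, _); apply: (points_of_inj fr1 fr2).
by have [->] := E.
Qed.

(** Sums the previous count over the doilies; [A] will be a condition on the dimension of the
    span. *)
Lemma card_frames_doily (A : pred (geometry N)) :
  #|[set g in frames | A (doily_of g)]| =
    (#|[set D | is_doily D && A D]| * #|symplectic_labels|)%N.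
Proof.
rewrite -sum_nat_const -sum1_card.
rewrite (partition_big doily_of (mem [set D | is_doily D && A D])) /=; last first.
  by case=> t r; rewrite !inE /= => /andP[fr ->]; rewrite doily_of_is_doily.
apply: eq_bigr => D; rewrite inE => /andP[dD AD].
rewrite -(card_frames_of_doily dD) -sum1_card; apply: eq_bigl => g.
rewrite !inE -andbA; case: eqP => [->|]; last by rewrite !andbF.
by rewrite AD.
Qed.

(** * Counting the frames over each tuple *)

Lemma card_orthogonal t :
  symplectic_tuple t ->
  (#|[set r | coords t r == label0]| * 16 = 4 ^ N)%N.
Proof.
move=> st; set R := [set r | _].
(* V is the direct sum of the span of [t], parametrized by the 16 labels, and its orthogonal
   complement, so [F] is a bijection onto V. *)
pose F (u : V * label) := u.1 + comb t u.2.
have FI : {in setX R setT &, injective F}.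
  move=> [r h] [r' h']; rewrite !inE !andbT /= => /eqP cr /eqP cr' E.
  have /= hh : h = h'.
    move: (congr1 (coords t) E); rewrite !coordsD cr cr' !coords_comb //.
    by case: (h) (h') => [[[? ?] ?] ?] [[[? ?] ?] ?].
  by move: E; rewrite hh => /addIr /= ->.
have <- : #|[set: label]| = 16%N by rewrite cardsT !card_prod card_bool.
rewrite -cardsX -(card_in_imset FI).
have -> : [set F u | u in setX R setT] = setT.
  apply/setP => x; rewrite inE; apply/imsetP.
  exists (x + comb t (coords t x), coords t x).
    by rewrite !inE andbT coordsD coords_comb // label_add_eq0.
  by rewrite /F /= -addrA addvv addr0.
by rewrite cardsT card_mx card_Fp // mul1n addnn -muln2 mulnC expnM.
Qed.

Lemma card_frames_cond (A : pred V) m :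
    (forall t, symplectic_tuple t ->
       #|[set r | (coords t r == label0) && A r]| = m) ->
  #|[set g in frames | A g.2]| =
    (#|[set t | symplectic_tuple t]| * m)%N.
Proof.
move=> cA; rewrite -sum_nat_const -sum1_card.
rewrite (partition_big fst (mem [set t | symplectic_tuple t])) /=; last first.
  by case=> t r; rewrite !inE /= => /andP[/andP[]].
apply: eq_bigr => t; rewrite inE => st; rewrite sum1dep_card -(cA t st).
rewrite -[RHS](card_imset _ (can_inj (f := pair t) (g := snd) (fun=> erefl))).
apply: eq_card => -[t' r]; rewrite !inE; apply/andP/imsetP => [[]|[r']].
  by move=> /andP[/andP[/= _ cr] Ar] /eqP <-; exists r; rewrite // inE cr.
by rewrite inE => /andP[cr Ar] [-> ->]; rewrite /= /frame st cr Ar eqxx.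
Qed.

(** * Dimension of the span *)

Definition tuple_seq t : 4.-tuple V := [tuple t.1.1.1; t.1.1.2; t.1.2; t.2].

Lemma span_points t r :
  <<enum (points_of t r)>>%VS = <<r :: tuple_seq t>>%VS.
Proof.
have [Pa Pc Pb Pd] := basis_in_points t r.
apply/eqP; rewrite eqEsubv; apply/andP; split; apply/span_subvP => x.
  rewrite mem_enum => /points_ofP[[[[h1 h2] h3] h4] _ ->].
  move: {Pa Pc Pb Pd} t => [[[a c] b] d].
  by rewrite /point /comb !(rpredD, rpredMn) //; apply: memv_span;
    rewrite !inE eqxx ?orbT.
have S y : y \in points_of t r -> y \in <<enum (points_of t r)>>%VS.
  by move=> yP; rewrite memv_span // mem_enum.
rewrite inE => /predU1P[->|]; last by rewrite !inE => /or4P[] /eqP->; apply: S.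
(* The relation r = b + d + e again, with [e] the point labelled (0,0,1,1). *)
have Er : r = t.1.2 + t.2 + point t r (false, false, true, true).
  move: {Pa Pc Pb Pd S} t => [[[a c] b] d].
  by rewrite /point /= !mulr0n !mulr1n !add0r addrA addvv add0r.
by rewrite [X in X \in _]Er; apply: rpredD; first apply: rpredD;
  apply: S => //; apply: points_of_mem.
Qed.

(** Scalars of F_2 read as booleans turn linear combinations into [comb]; the second clause serves
    the independence of the tuple. *)
Lemma tuple_seq_sum t (k : 'I_4 -> 'F_2) :
  exists h, \sum_(i < 4) k i *: (tuple_seq t)`_i = comb t h /\
    (h = label0 -> forall i, k i = 0).
Proof.
have scale (u : 'F_2) (v : V) : u *: v = v *+ (u != 0).
  have [-> | u0] := eqVneq u 0; first by rewrite scale0r.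
  rewrite -[RHS]scale1r; congr (_ *: _).
  by case: u u0 => [[|[|u]] hu] // _; apply/val_inj.
pose i1 : 'I_4 := lift ord0 ord0; pose i2 : 'I_4 := lift ord0 (lift ord0 ord0).
pose i3 : 'I_4 := lift ord0 (lift ord0 (lift ord0 ord0)).
exists (k ord0 != 0, k i1 != 0, k i2 != 0, k i3 != 0); split.
  rewrite !big_ord_recl big_ord0 addr0 !scale !addrA.
  by case: t => [[[a c] b] d].
case=> /negbFE/eqP k0 /negbFE/eqP k1 /negbFE/eqP k2 /negbFE/eqP k3 i.
case: i => [[|[|[|[|i]]]] hi] //; [rewrite -k0 | rewrite -k1 | rewrite -k2 | rewrite -k3];
  by congr (k _); apply/val_inj.
Qed.

(** The tuple is free because [coords] recovers labels. A nonzero [r] lies outside its span, since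
    its coordinates vanish. *)
Lemma span_dim_doily_of t r :
  frame t r -> span_dim (doily_of (t, r)) = (4 + (r != 0)%R)%N.
Proof.
case/andP=> st /eqP cr; rewrite /span_dim span_points.
have free4 : free (tuple_seq t).
  apply/freeP => k; have [h [-> h0]] := tuple_seq_sum t k.
  by move/(congr1 (coords t)); rewrite coords_comb // coords0.
have [-> | r0] := eqVneq r 0.
  have -> : <<0%R :: tuple_seq t>>%VS = <<tuple_seq t>>%VS.
    by rewrite span_cons; apply/addv_idPr; rewrite -memvE mem0v.
  exact/eqP.
suff : free (r :: tuple_seq t) by move/eqP.
rewrite free_cons free4 andbT; apply: contra r0 => /coord_span Er.
have [h [Eh _]] := tuple_seq_sum t (coord (tuple_seq t) ^~ r).
rewrite Eh in Er; rewrite Er coords_comb // in cr.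
by rewrite Er cr comb0.
Qed.

End Symplectic.

Theorem mainTheorem5 (N : nat) (hN : (3 <= N)%N) :
  num_quadratic N = ((4 ^ (N - 2) - 1) * num_linear N)%N /\
  num_doilies N = (4 ^ (N - 2) * num_linear N)%N.
Proof.
have N2 : (2 <= N)%N := ltnW hN.
have K0 := symplectic_labels_gt0.
have cR t : symplectic_tuple t ->
    #|[set r : 'rV['F_2]_(N + N) | coords t r == label0]| = (4 ^ (N - 2))%N.
  move=> /card_orthogonal E; apply/eqP; rewrite -(@eqn_pmul2r 16) // E.
  by rewrite -[16%N]/(4 ^ 2)%N -expnD subnK.
(* First count, tuple by tuple: one choice for r = 0, and 4^(N-2) - 1 choices for r nonzero. *)
have Fl : #|[set g in frames N | g.2 == 0]| =
    #|[set t : 'rV['F_2]_(N + N) * _ * _ * _ | symplectic_tuple t]|.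
  rewrite (card_frames_cond (A := pred1 0) (m := 1)) ?muln1 // => t st.
  rewrite -[RHS](cards1 (0 : 'rV['F_2]_(N + N))); apply: eq_card => r; rewrite !inE.
  by case: (eqVneq r 0) => [->|_]; rewrite ?andbF ?coords0 ?eqxx.
have Fq : #|[set g in frames N | g.2 != 0]| =
    (#|[set t : 'rV['F_2]_(N + N) * _ * _ * _ | symplectic_tuple t]|
      * (4 ^ (N - 2) - 1))%N.
  rewrite (card_frames_cond (A := predC1 0) (m := 4 ^ (N - 2) - 1)) // => t st.
  rewrite -(cR t st) (cardsD1 0 [set r | coords t r == label0]).
  rewrite inE coords0 eqxx add1n subn1 /=; apply: eq_card => r.
  by rewrite !inE andbC.
have Fa : #|frames N| = (#|[set g in frames N | (g.2 == 0)%R]| * 4 ^ (N - 2))%N.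
  rewrite Fl -(card_frames_cond (A := predT)) => [|t st].
    by apply: eq_card => g; rewrite inE andbT.
  by rewrite -(cR t st); apply: eq_card => r; rewrite !inE andbT.
have dimE (g : 'rV['F_2]_(N + N) * _ * _ * _ * _) : g \in frames N ->
    span_dim (doily_of g) = (4 + (g.2 != 0)%R)%N.
  by case: g => t r; rewrite inE => /span_dim_doily_of.
(* Second count of the same frames, doily by doily: by [dimE], r = 0 corresponds to linear and r
   nonzero to quadratic doilies. *)
have El : #|[set g in frames N | g.2 == 0]| = (num_linear N * #|symplectic_labels|)%N.
  rewrite -(card_frames_doily (fun D => span_dim D == 4%N)).
  apply: eq_card => g; rewrite !inE; case gF: (frame _ _) => //=.
  by rewrite dimE ?inE //; case: eqP.
have Eq : #|[set g in frames N | g.2 != 0]| = (num_quadratic N * #|symplectic_labels|)%N.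
  rewrite -(card_frames_doily (fun D => span_dim D == 5%N)).
  apply: eq_card => g; rewrite !inE; case gF: (frame _ _) => //=.
  by rewrite dimE ?inE //; case: eqP.
have Ea : #|frames N| = (num_doilies N * #|symplectic_labels|)%N.
  rewrite (_ : num_doilies N = #|[set D : geometry N | is_doily D && true]|).
    by rewrite -card_frames_doily; apply: eq_card => g; rewrite inE andbT.
  by apply: eq_card => D; rewrite !inE andbT.
split; apply/eqP; rewrite -(eqn_pmul2r K0).
  by rewrite -Eq Fq -Fl El mulnC mulnA.
by rewrite -Ea Fa El mulnC mulnA.
Qed.
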